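(* Let $k\ge 0$ be an integer, let $n\ge 1$, and let $A:\mathbb{R}\to\mathbb{C}^{n\times n}$ be of class $\mathcal{C}^k$ with $A(t)^T=A(t)$ for all $t\in\mathbb{R}$. Suppose that for every $t\in\mathbb{R}$ the singular values of $A(t)$ are pairwise distinct and positive. Then there exist functions $U:\mathbb{R}\to\mathbb{C}^{n\times n}$ and $S:\mathbb{R}\to\mathbb{R}^{n\times n}$, both of class $\mathcal{C}^k$, such that for all $t\in\mathbb{R}$: $U(t)$ is unitary, $S(t)=\operatorname{diag}(\sigma_1(t),\dots,\sigma_n(t))$ with $\sigma_1(t)>\dots>\sigma_n(t)>0$, and $$A(t)=U(t)S(t)U(t)^T.$$
   Context: $U^T$ denotes the transpose without complex conjugation. A factorization $A=USU^T$ of a complex symmetric matrix with $U$ unitary and $S$ diagonal with nonnegative, decreasingly ordered entries (the singular values of $A$) is called a Takagi factorization. *)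

(* Defs.v *)
From HB Require Import structures.
From mathcomp Require Import all_boot all_order all_algebra.
From mathcomp Require Import all_classical all_reals all_analysis.
From mathcomp Require Import complex.

Set Implicit Arguments.
Unset Strict Implicit.
Unset Printing Implicit Defensive.

Import Order.TTheory GRing.Theory Num.Theory.
Import numFieldNormedType.Exports.

Local Open Scope ring_scope.
Local Open Scope complex_scope.
Local Open Scope sesquilinear_scope.

Definition class_C (R : realType) (k : nat) (f : R -> R) : Prop :=
  (forall j, (j < k)%N -> forall t : R, derivable (derive1n j f) t 1) /\
  continuous (derive1n k f).

Definition class_C_mx (R : realType) (k m n : nat) (M : R -> 'M[R]_(m, n)) :
    Prop :=
  forall i j, class_C k (fun t => M t i j).

(* Differentiability is with respect to the real variable [t], so [R[i]] is
   taken as the real vector space [R * R]. *)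
Definition class_C_cmx (R : realType) (k m n : nat)
    (M : R -> 'M[R[i]]_(m, n)) : Prop :=
  class_C_mx k (fun t => map_mx (@complex.Re R) (M t)) /\
  class_C_mx k (fun t => map_mx (@complex.Im R) (M t)).

(* Square roots of the eigenvalues of A^* A. These eigenvalues are real and
   nonnegative, and [spectral_diag] lists them with multiplicity, in an
   unspecified order. *)
Definition singular_value (R : realType) (n : nat) (A : 'M[R[i]]_n)
    (i : 'I_n) : R :=
  Num.sqrt (complex.Re (spectral_diag (A ^t* *m A) 0 i)).

(* Main.v *)
(* At a fixed t, diagonalise A^* A = W^* D W with W unitary and D the diagonal
   matrix of the squared singular values. The matrix C = conj(W) A W^* is
   symmetric with conj(C) C = D = C conj(C), so it commutes with D; the entries
   of D being distinct, C is diagonal, and taking square roots of its phases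
   gives A = U S U^T. The columns of U are determined up to sign.

   The squares lam_i of the singular values are the simple roots of the
   characteristic polynomial p_t of A A^*, whose coefficients c_m are C^k. Since
   |p_t(lam_i(s))| = prod_j |lam_i(s) - lam_j(t)| tends to 0 as t tends to s, the
   roots are continuous; dividing p_t(lam_i(t)) - p_s(lam_i(s)) = 0 by t - s gives
     lam_i' = - (sum_m c_m' lam_i^m) / prod_(j != i) (lam_i - lam_j),
   and induction on k shows that lam_i is C^k.

   If u is the i-th column of U, then u u^* and u u^T are obtained from
   prod_(j != i) (A A^* - lam_j), hence are C^k although u need not be. So all
   products of two among the real and imaginary parts e_1, ..., e_2n of the
   entries of u are C^k. Near a point where e_a does not vanish, e_a e_b / |e_a|
   is C^k: locally, a choice of signs makes u of class C^k. Two such choices on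
   an interval agree up to a constant sign, which makes it possible to glue the
   local choices into one on the whole line. *)

Require Import Defs.
From HB Require Import structures.
From mathcomp Require Import all_boot all_order all_algebra.
From mathcomp Require Import perm.
From mathcomp Require Import all_classical all_reals all_analysis.
From mathcomp Require Import complex lra ring.

Set Implicit Arguments.
Unset Strict Implicit.
Unset Printing Implicit Defensive.

Import Order.TTheory GRing.Theory Num.Theory.
Import numFieldNormedType.Exports.

Local Open Scope ring_scope.
Local Open Scope complex_scope.
Local Open Scope classical_set_scope.

(** * Functions of class C^k on an open set *)

Section Smooth.
Variable R : realType.
Implicit Types (f g : R -> R) (D : set R).

Fixpoint smooth k D f : Prop :=
  if k is k'.+1 then
    (forall t, D t -> derivable f t 1) /\ smooth k' D f^`()
  else forall t, D t -> {for t, continuous f}.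

Lemma smooth_class_C k f : smooth k setT f <-> class_C k f.
Proof.
elim: k f => [|k IH] f.
  by split=> [h|[_ h] t _]; [split=> // t; exact: h|exact: h].
split=> [[h /IH[h1 h2]]|[h1 h2]].
  split=> [[_ t|j]|]; first exact: h.
    by rewrite ltnS derive1Sn => /h1.
  by rewrite derive1Sn.
split=> [t _|]; first exact: (h1 0).
apply/IH; split=> [j jk|]; last by rewrite -derive1Sn.
by rewrite -derive1Sn; apply: h1.
Qed.

Lemma derive1_eq_near f g t : (\near t, f t = g t) -> f^`() t = g^`() t.
Proof. by move=> fg; rewrite !derive1E; apply: near_eq_derive. Qed.

(** Continuity, differentiability and the value of the derivative at a point depend only on the germ
    there. This is the tool for pasting local formulas together. *)
Lemma smooth_near k D f :
  (forall t, D t -> exists E g, [/\ open E, E t, smooth k E g &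
     forall s, E s -> f s = g s]) -> smooth k D f.
Proof.
elim: k D f => [|k IH] D f h /=.
  move=> t /h[E [g [oE Et sg fg]]].
  have nE : \forall s \near t, E s by apply: open_nbhs_nbhs.
  have := sg _ Et; rewrite /prop_for /continuous_at (fg _ Et) => gt.
  apply: cvg_trans gt; apply: near_eq_cvg.
  by apply: filterS nE => s /fg.
split=> [t /h[E [g [oE Et [dg sg] fg]]]|].
  have nE : \forall s \near t, E s by apply: open_nbhs_nbhs.
  apply: (@near_eq_derivable _ _ _ g) (dg _ Et).
  by apply: filterS nE => s /fg.
apply: IH => t /h[E [g [oE Et [dg sg] fg]]]; exists E, g^`(); split=> // s Es.
have nE : \forall x \near s, E x by apply: open_nbhs_nbhs.
by apply: derive1_eq_near; apply: filterS nE => x /fg.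
Qed.

Lemma smooth_sub k D E f : E `<=` D -> smooth k D f -> smooth k E f.
Proof.
elim: k f => [|k IH] f ED /=; first by move=> h t /ED /h.
by move=> [h1 h2]; split=> [t /ED/h1//|]; apply: IH.
Qed.

Lemma eq_smooth k D f g : open D -> (forall t, D t -> f t = g t) ->
  smooth k D g -> smooth k D f.
Proof. by move=> oD fg sg; apply: smooth_near => t Dt; exists D, g. Qed.

Lemma smooth_cst k D c : smooth k D (fun=> c).
Proof.
elim: k c => [|k IH] c /=; first by move=> t _; apply: cvg_cst.
split=> [t _|]; first exact: derivable_cst.
rewrite (_ : _^`() = fun=> 0) //; apply/funext => t.
by rewrite derive1_cst.
Qed.

Lemma smooth_continuous k D f : smooth k D f ->
  forall t, D t -> {for t, continuous f}.
Proof.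
case: k => [|k] //= [h _] t Dt.
by apply: differentiable_continuous; apply/derivable1_diffP; apply: h.
Qed.

Lemma smoothS k D f : smooth k.+1 D f -> smooth k D f.
Proof.
elim: k D f => [|k IH] D f; first exact: (@smooth_continuous 1).
by move=> [h1 h2]; split=> //; apply: IH.
Qed.

Lemma smoothD k D f g : open D -> smooth k D f -> smooth k D g ->
  smooth k D (fun t => f t + g t).
Proof.
move=> oD; elim: k f g => [|k IH] f g /=.
  by move=> hf hg t Dt; apply: cvgD; [apply: hf|apply: hg].
move=> [df sf] [dg sg]; split=> [t Dt|].
  by apply: derivableD; [apply: df|apply: dg].
apply: eq_smooth (IH _ _ sf sg) => // t Dt.
by rewrite !derive1E deriveD //; [apply: df|apply: dg].
Qed.

Lemma smoothM k D f g : open D -> smooth k D f -> smooth k D g ->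
  smooth k D (fun t => f t * g t).
Proof.
move=> oD; elim: k f g => [|k IH] f g.
  by move=> hf hg t Dt; apply: cvgM; [apply: hf|apply: hg].
move=> sf sg; have [df sf'] := sf; have [dg sg'] := sg => /=; split=> [t Dt|].
  by apply: derivableM; [apply: df|apply: dg].
apply: (@eq_smooth _ _ _ (fun t => f t * derive1 g t + g t * derive1 f t)) => //.
  move=> t Dt; rewrite !derive1E deriveM //; [apply: df|apply: dg] => //.
by apply: smoothD => //; apply: IH => //; apply: smoothS.
Qed.

Lemma smoothN k D f : open D -> smooth k D f -> smooth k D (fun t => - f t).
Proof.
move=> oD sf; under eq_fun do rewrite -mulN1r.
by apply: smoothM => //; apply: smooth_cst.
Qed.

Lemma smoothB k D f g : open D -> smooth k D f -> smooth k D g ->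
  smooth k D (fun t => f t - g t).
Proof. by move=> oD sf sg; apply: smoothD => //; apply: smoothN. Qed.

Lemma smoothV k D f : open D -> (forall t, D t -> f t != 0) -> smooth k D f ->
  smooth k D (fun t => (f t)^-1).
Proof.
move=> oD f0; elim: k => [|k IH].
  by move=> hf t Dt; apply: cvgV; [apply: f0|apply: hf].
move=> sf; have [df sf'] := sf => /=; split=> [t Dt|].
  by apply: derivableV; [apply: f0|apply: df].
apply: (@eq_smooth _ _ _ (fun t => - ((f t)^-1 * (f t)^-1) * derive1 f t)) => //.
  move=> t Dt; rewrite !derive1E deriveV ?f0 //; last exact: df.
  by rewrite /GRing.scale /= expr2 invfM.
have sV := IH (smoothS sf).
by apply: smoothM => //; apply: smoothN => //; apply: smoothM.
Qed.

(** The derivative [f' / (2 sqrt f)] needs one order of smoothness of [sqrt f] less, which the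
    induction hypothesis supplies. *)
Lemma smooth_sqrt k D f : open D -> (forall t, D t -> 0 < f t) -> smooth k D f ->
  smooth k D (fun t => Num.sqrt (f t)).
Proof.
move=> oD f0; elim: k => [|k IH].
  move=> hf t Dt; apply: (@continuous_comp _ _ _ f); first exact: hf.
  exact: sqrt_continuous.
move=> sf; have [df sf'] := sf.
have ds t : D t -> derivable Num.sqrt (f t) 1.
  by move=> Dt; have [] := is_derive1_sqrt (f0 _ Dt).
rewrite /=; split=> [t Dt|].
  apply/derivable1_diffP; apply: differentiable_comp; apply/derivable1_diffP.
    exact: df.
  exact: ds.
apply: (@eq_smooth _ _ _ (fun t => (2 * Num.sqrt (f t))^-1 * derive1 f t)) => //.
  move=> t Dt; rewrite -[LHS]/((Num.sqrt \o f)^`() t).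
  rewrite derive1_comp; [|exact: df|exact: ds].
  by rewrite [X in X * _]derive1E derive_sqrt ?f0.
apply: smoothM => //; apply: smoothV => //.
  by move=> t Dt; rewrite mulf_neq0 ?gt_eqF ?sqrtr_gt0 ?f0.
by apply: smoothM (IH (smoothS sf)) => //; apply: smooth_cst.
Qed.

Lemma smooth_sum k D (I : Type) (r : seq I) (P : pred I) (F : I -> R -> R) :
  open D -> (forall i, P i -> smooth k D (F i)) ->
  smooth k D (fun t => \sum_(i <- r | P i) F i t).
Proof.
move=> oD sF; elim: r => [|i r IH].
  by apply: eq_smooth (smooth_cst _ _ 0) => // t _; rewrite big_nil.
have [Pi|Pi] := boolP (P i).
  apply: (eq_smooth _ _ (smoothD oD (sF i Pi) IH)) => // t _.
  by rewrite big_cons Pi.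
by apply: (eq_smooth _ _ IH) => // t _; rewrite big_cons (negbTE Pi).
Qed.

Lemma smooth_prod k D (I : Type) (r : seq I) (P : pred I) (F : I -> R -> R) :
  open D -> (forall i, P i -> smooth k D (F i)) ->
  smooth k D (fun t => \prod_(i <- r | P i) F i t).
Proof.
move=> oD sF; elim: r => [|i r IH].
  by apply: eq_smooth (smooth_cst _ _ 1) => // t _; rewrite big_nil.
have [Pi|Pi] := boolP (P i).
  apply: (eq_smooth _ _ (smoothM oD (sF i Pi) IH)) => // t _.
  by rewrite big_cons Pi.
by apply: (eq_smooth _ _ IH) => // t _; rewrite big_cons (negbTE Pi).
Qed.

Lemma smoothX k D f m : open D -> smooth k D f ->
  smooth k D (fun t => f t ^+ m).
Proof.
move=> oD sf; elim: m => [|m IH].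
  by apply: eq_smooth (smooth_cst _ _ 1) => // t _; rewrite expr0.
by apply: (eq_smooth _ _ (smoothM oD sf IH)) => // t _; rewrite exprS.
Qed.

End Smooth.

(** * Simple roots of a real-rooted polynomial *)

(** Monotonicity gives [i <= f i] for all [i]; as [f] permutes the indices, both sides have the same
    sum, so every inequality is an equality. *)
Lemma increasing_ord_id n (f : 'I_n -> 'I_n) :
  (forall i j : 'I_n, (i < j)%N -> (f i < f j)%N) -> forall i, f i = i.
Proof.
move=> f_incr.
have f_inj : injective f.
  move=> i j fij; apply/val_inj => /=.
  by case: (ltngtP i j) => // /f_incr; rewrite fij ltnn.
have f_ge (i : 'I_n) : (i <= f i)%N.
  case: i => m; elim: m => [|m IH] lt_mn //=.
  have lt_mn' := ltnW lt_mn.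
  apply: leq_ltn_trans (IH lt_mn') _.
  exact: (f_incr (Ordinal lt_mn') (Ordinal lt_mn)) (ltnSn m).
have le_f (i : 'I_n) : true -> (i <= f i ?= iff (i == f i :> nat))%N.
  by move=> _; split.
have [_] := leqif_sum le_f.
rewrite [X in X == _](reindex_inj f_inj) eqxx.
by move=> /esym/forallP h i; apply/val_inj/esym/eqP/(h i).
Qed.

Section Roots.
Variables (R : realType) (n : nat) (lam : 'I_n -> R -> R).
Hypothesis lam_decr : forall t (i j : 'I_n), (i < j)%N -> lam j t < lam i t.

Let p t := \prod_i ('X - (lam i t)%:P).

Lemma horner_roots t x : (p t).[x] = \prod_i (x - lam i t).
Proof. by rewrite horner_prod; apply: eq_bigr => i _; rewrite !hornerE. Qed.

Lemma horner_roots_coef t x : (p t).[x] = \sum_(m < n.+1) (p t)`_m * x ^+ m.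
Proof.
by apply: horner_coef_wide; rewrite size_prod_XsubC [index_enum _]unlock
  -enumT size_enum_ord.
Qed.

Lemma horner_at_root t i : (p t).[lam i t] = 0.
Proof. by rewrite horner_roots (bigD1 i) //= subrr mul0r. Qed.

Lemma roots_inj t : injective (lam^~ t).
Proof.
move=> i j; case: (ltngtP i j) => [/(lam_decr t)|/(lam_decr t)|ij _].
- by move=> + e; rewrite e ltxx.
- by move=> + e; rewrite e ltxx.
- exact: val_inj.
Qed.

Hypothesis coef_cont : forall m, continuous (fun t => (p t)`_m : R).

Lemma horner_roots_cont x : continuous (fun t => (p t).[x]).
Proof.
have: smooth 0 setT (fun t => (p t).[x]).
  apply: (eq_smooth _ (fun t _ => horner_roots_coef t x)); first exact: openT.
  apply: smooth_sum => [|m _]; first exact: openT.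
  apply: smoothM; [exact: openT|by move=> t _; apply: coef_cont|].
  exact: smooth_cst.
by move=> h t; apply: h.
Qed.

Lemma roots_near (t0 e : R) : 0 < e ->
  \forall t \near t0, forall i, `|lam i t0 - lam i t| < e.
Proof.
move=> e0.
(* The open intervals of radius [d] around the roots at [t0] are pairwise disjoint. *)
have [d [d0 de dgap]] : exists d, [/\ 0 < d, d <= e &
    forall i j : 'I_n, (i < j)%N -> lam j t0 + d <= lam i t0 - d].
  have: \forall d \near (0 : R)^'+,
      forall i j : 'I_n, (i < j)%N -> lam j t0 + d <= lam i t0 - d.
    apply: filter_forall => i; apply: filter_forall => j.
    case: ltnP => // ij; last by near=> d.
    near=> d => _.
    have : d < (lam i t0 - lam j t0) / 2.
      by near: d; apply: nbhs_right_lt; rewrite divr_gt0 ?subr_gt0 ?lam_decr.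
    by rewrite ltr_pdivlMr // => /ltW; lra.
  move=> /filterI/(_ (nbhs_right_gt 0))/filterI/(_ (nbhs_right_lt e0)).
  by move=> /filter_ex[d [[? ?] ?]]; exists d; split=> //; apply: ltW.
have small : \forall t \near t0, forall i, `|(p t).[lam i t0]| < d ^+ n.
  apply: (@filter_forall _ _ (fun i t => `|(p t).[lam i t0]| < d ^+ n)
    (nbhs t0)) => i.
  have := @horner_roots_cont (lam i t0) t0.
  move=> /cvgrPdist_lt /(_ (d ^+ n)); rewrite exprn_gt0 // => /(_ isT).
  by apply: filterS => t; rewrite horner_at_root sub0r normrN.
apply: filterS small => t small.
(* If all [n] factors of [p_t(lam_i(t0))] had modulus at least [d], the product would be at least
   [d ^+ n]. *)
have close i : exists j, `|lam i t0 - lam j t| < d.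
  apply: contrapT => /forallNP far; have := small i.
  rewrite horner_roots normr_prod ltNge => /negP; apply.
  rewrite -[X in d ^+ X](card_ord n) -prodr_const.
  apply: ler_prod => j _; rewrite ltW //= leNgt; exact/negP/far.
have [f fP] := choice close.
(* The root matched with [lam i t0] lies in its interval, and these intervals are ordered, so the
   matching preserves the order of the indices. *)
have fE : forall i, f i = i.
  apply: increasing_ord_id => i j ij.
  have := dgap _ _ ij; have := fP i; have := fP j.
  rewrite !ltr_distlC => /andP[h1 h2] /andP[h3 h4] h5.
  have : lam (f j) t < lam (f i) t by lra.
  apply: contraTltn; rewrite leq_eqVlt => /orP[/eqP/val_inj ->|/(lam_decr t)].
    by rewrite ltxx.
  by move=> /ltW; rewrite leNgt.
by move=> i; rewrite -{2}(fE i); apply: lt_le_trans (fP i) de.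
Unshelve. all: by end_near. Qed.

Lemma roots_continuous i : continuous (lam i).
Proof.
move=> t0; apply/cvgrPdist_lt => e e0.
by apply: filterS (roots_near t0 e0) => t; apply.
Qed.

End Roots.

Lemma is_derive_quotient (R : realType) (f : R -> R) (s l : R) :
  is_derive s (1 : R) f l <->
  h^-1 * (f (h + s) - f s) @[h --> (0 : R)^'] --> l.
Proof.
have quotE : (fun h => h^-1 *: ((f \o shift s) (h *: (1 : R)) - f s)) =
    (fun h => h^-1 * (f (h + s) - f s)).
  by apply/funext => h; rewrite /= /GRing.scale /= mulr1.
split=> [[+ +]|dl]; rewrite ?/derivable ?/derive ?quotE.
  by move=> /cvg_ex[l' dl']; rewrite (cvg_lim _ dl') // => <-.
split; rewrite ?/derivable ?/derive quotE; last exact: cvg_lim.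
by apply/cvg_ex; exists l.
Qed.

Section RootsSmooth.
Variables (R : realType) (n : nat) (lam : 'I_n -> R -> R).
Hypothesis lam_decr : forall t (i j : 'I_n), (i < j)%N -> lam j t < lam i t.

Let p t := \prod_i ('X - (lam i t)%:P).

(* Subtracting [p_s(lam_i s) = 0] from [p_t(lam_i t) = 0] and splitting the
   difference through [p_s(lam_i t)]. *)
Lemma root_increment s t i :
  (lam i t - lam i s) * \prod_(j | j != i) (lam i t - lam j s) =
  - \sum_(m < n.+1) ((p t)`_m - (p s)`_m) * lam i t ^+ m.
Proof.
rewrite (eq_bigr _ (fun m _ => mulrBl _ _ _)) sumrB -!horner_roots_coef.
rewrite horner_at_root sub0r opprK horner_roots.
by rewrite [RHS](bigD1 i).
Qed.

Let gap s i := \prod_(j | j != i) (lam i s - lam j s).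

Lemma gap_neq0 s i : gap s i != 0.
Proof.
apply/prodf_neq0 => j ji; rewrite subr_eq0; apply: contra ji => /eqP.
by move/(roots_inj lam_decr) ->.
Qed.

(** Divide [root_increment] by the increment of the variable and by the product on its left.
    Continuity of the roots makes that product tend to [gap s i], which is nonzero because the roots
    are simple. *)
Lemma is_derive_root s i : (forall m, derivable (fun t => (p t)`_m : R) s 1) ->
  (forall m, continuous (fun t => (p t)`_m : R)) ->
  is_derive s (1 : R) (lam i)
    (- (\sum_(m < n.+1) derive1 (fun t => (p t)`_m : R) s * lam i s ^+ m)
     / gap s i).
Proof.
move=> dp cp.
have sl j : smooth 0 setT (lam j) by move=> t _; apply: roots_continuous.
pose g t := \prod_(j | j != i) (lam i t - lam j s).
have sg : smooth 0 setT g.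
  apply: smooth_prod => [|j _]; first exact: openT.
  apply: smoothB => //; [exact: openT|exact: smooth_cst].
have shift_s : h + s @[h --> (0 : R)^'] --> s.
  rewrite -[X in _ --> X]add0r; apply: cvgD; last exact: cvg_cst.
  exact: nbhs_dnbhs.
have cg : g (h + s) @[h --> (0 : R)^'] --> gap s i.
  by apply: (cvg_comp _ _ shift_s); apply: sg.
have quot : h^-1 * (lam i (h + s) - lam i s) @[h --> (0 : R)^'] -->
    - (\sum_(m < n.+1) derive1 (fun t => (p t)`_m : R) s * lam i s ^+ m)
    / gap s i.
  have lim_quot : - (\sum_(m < n.+1) h^-1 * ((p (h + s))`_m - (p s)`_m) *
      lam i (h + s) ^+ m) / g (h + s) @[h --> (0 : R)^'] -->
    - (\sum_(m < n.+1) derive1 (fun t => (p t)`_m : R) s * lam i s ^+ m)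
    / gap s i.
    apply: cvgM; last by apply: cvgV => //; apply: gap_neq0.
    apply: cvgN; apply: (@cvg_big R _ _ _ _ add_continuous) => m _.
    apply: cvgM; last first.
      apply: (@cvg_comp _ _ _ _ (fun t => lam i t ^+ m) _ _ _ shift_s).
      exact: (smoothX m openT (sl i) s I).
    rewrite derive1E.
    exact: (is_derive_quotient (fun t => (p t)`_m) s _).1 (derivableP (dp m)).
  apply: cvg_trans lim_quot; apply: near_eq_cvg.
  near=> h; have g0 : g (h + s) != 0.
    by near: h; exact: cvgr_neq0 cg (gap_neq0 s i).
  apply: (mulIf g0); rewrite mulfVK // -mulrA root_increment mulrN.
  by rewrite mulr_sumr; congr (- _); apply: eq_bigr => m _; rewrite mulrA.
by apply/is_derive_quotient.
Unshelve. all: by end_near. Qed.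

(** The formula for the derivative involves the roots themselves and first derivatives of
    coefficients only, all of class C^k when the coefficients are C^(k+1). *)
Lemma smooth_root k : (forall m, smooth k setT (fun t => (p t)`_m)) ->
  forall i, smooth k setT (lam i).
Proof.
elim: k => [|k IH] sp i.
  by move=> t _; apply: roots_continuous => // m s; apply: sp.
have sl := IH (fun m => smoothS (sp m)).
have dl s j := @is_derive_root s j (fun m => (sp m).1 s I)
  (fun m s => smooth_continuous (sp m) I).
split=> [t _|]; first by case: (dl t i).
pose dp m : R -> R := derive1 (fun t => (p t)`_m : R).
have sdp m : smooth k setT (dp m) by case: (sp m).
apply: (@eq_smooth _ _ _ _ (fun s => - (\sum_(m < n.+1) dp m s * lam i s ^+ m)
   * (gap s i)^-1)); first exact: openT.
  by move=> t _; rewrite derive1E; case: (dl t i) => _ ->.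
apply: smoothM; first exact: openT.
  apply: smoothN; first exact: openT.
  apply: smooth_sum => [|m _]; first exact: openT.
  by apply: smoothM; [exact: openT| |apply: smoothX => //; exact: openT].
apply: smoothV => [|t _|]; [exact: openT|exact: gap_neq0|].
apply: smooth_prod => [|j _]; first exact: openT.
by apply: smoothB => //; exact: openT.
Qed.

End RootsSmooth.

(** * Lifting signs along the real line *)

Lemma subset_itv_oo (R : realType) (a b c d : R) : c <= a -> b <= d ->
  `]a, b[%classic `<=` `]c, d[%classic.
Proof.
move=> ca bd x; rewrite /= !in_itv /= => /andP[ax xb].
by rewrite (le_lt_trans ca ax) (lt_le_trans xb bd).
Qed.

Lemma itv_oppE (R : realType) (r t : R) :
  `]- r, r[%classic t = (`|t| < r) :> Prop.
Proof. by rewrite /= in_itv /= ltr_norml. Qed.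

Section Lift.
Variables (R : realType) (k : nat) (J : finType) (e : J -> R -> R).
Hypothesis smooth_e2 : forall a b, smooth k setT (fun t => e a t * e b t).
Hypothesis e_neq0 : forall t, exists a, e a t != 0.

(** A sign is a real number of square 1. The condition holds on the whole line, even where only
    local smoothness of [s t * e a t] is at stake. *)
Let sign_fun (s : R -> R) := forall t, s t * s t = 1.
Let lift D s := sign_fun s /\ forall a, smooth k D (fun t => s t * e a t).

Let lift_sub D E s : E `<=` D -> lift D s -> lift E s.
Proof. by move=> ED [ss sf]; split=> // a; apply: smooth_sub (sf a). Qed.

(** Take for [s] the sign of a coordinate [e a] with [e a t != 0]. Its square is continuous, hence
    positive near [t], and there [s * e b] equals [e a * e b / sqrt (e a * e a)]. *)
Let lift_local t : exists r s, 0 < r /\ lift `]t - r, t + r[%classic s.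
Proof.
have [a ea] := e_neq0 t.
have : \forall u \near t, 0 < e a u * e a u.
  have := smooth_continuous (smooth_e2 a a) (t := t) I.
  move=> /cvgr_gt; apply.
  by rewrite -expr2 exprn_even_gt0.
move=> /nbhs_ballP[r r0 pos]; exists r, (fun u => if e a u < 0 then -1 else 1).
split=> //; split=> [u|b]; first by case: ifP; rewrite ?mulrNN mulr1.
have pos' u : `]t - r, t + r[%classic u -> 0 < e a u * e a u.
  move=> /=; rewrite in_itv /= => u_itv.
  by apply: pos; rewrite ball_itv /= in_itv.
have oitv : open `]t - r, t + r[%classic by exact: itv_open.
apply: (eq_smooth oitv
  (g := fun u => e a u * e b u * (Num.sqrt (e a u * e a u))^-1)).
  move=> u /pos' ea0; rewrite -expr2 sqrtr_sqr.
  have ea1 : e a u != 0 by apply: contraL ea0 => /eqP ->; rewrite mul0r ltxx.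
  rewrite mulrAC; congr (_ * _); case: ltP => ea2.
    by rewrite ltr0_norm // invrN mulrN divff.
  by rewrite ger0_norm // divff.
apply: smoothM => //; first exact: smooth_sub (smooth_e2 a b).
apply: smoothV => // [u /pos' ?|]; first by rewrite gt_eqF // sqrtr_gt0.
by apply: smooth_sqrt => //; exact: smooth_sub (smooth_e2 a a).
Qed.

(** The product [s * s'] is continuous on the interval and takes only the values 1 and -1, so it is
    constant. *)
Let lift_rigid x y s s' :
  lift `]x, y[%classic s -> lift `]x, y[%classic s' ->
  forall t u, `]x, y[%classic t -> `]x, y[%classic u ->
  s t * s' t = s u * s' u.
Proof.
move=> [ss sl] [ss' sl'].
have oitv : open `]x, y[%classic by exact: itv_open.
pose f t := s t * s' t.
have f2 t : f t ^+ 2 = 1 by rewrite expr2 mulrACA ss ss' mulr1.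
have cf t : `]x, y[%classic t -> {for t, continuous f}.
  suff : smooth 0 `]x, y[%classic f by apply.
  have cl r a : smooth k `]x, y[%classic (fun t => r t * e a t) ->
    smooth 0 `]x, y[%classic (fun t => r t * e a t) by exact: smooth_continuous.
  have e2_gt0 v : 0 < \sum_a e a v * e a v.
    have [a ea] := e_neq0 v; rewrite (bigD1 a) //=.
    rewrite ltr_pwDl ?sumr_ge0 // => [|b _]; rewrite -expr2.
      by rewrite exprn_even_gt0.
    exact: sqr_ge0.
  apply: (eq_smooth oitv (g := fun t => (\sum_a (s t * e a t) * (s' t * e a t)) *
    (\sum_a e a t * e a t)^-1)).
    move=> v _; apply: (canRL (mulfK _)); first by rewrite gt_eqF.
    by rewrite mulr_sumr; apply: eq_bigr => a _; rewrite mulrACA.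
  apply: smoothM => //.
    by apply: smooth_sum => // a _; apply: smoothM => //; apply: cl.
  apply: smoothV => // [v _|]; first by rewrite gt_eqF.
  apply: smooth_sum => // a _.
  by move=> v _; apply: (smooth_continuous (smooth_e2 a a)).
suff le : forall v w, v <= w -> `]x, y[%classic v -> `]x, y[%classic w ->
  f v = f w.
  move=> t u tx ux; case: (leP t u) => [tu|/ltW ut]; first exact: le.
  by apply/esym; apply: le.
move=> t u tu tx ux; apply: contrapT => fneq.
(* Two different signs are opposite, so [f] would vanish in between, against [f ^+ 2 = 1]. *)
have fN : f u = - f t.
  move: (f2 t) (f2 u) => /eqP; rewrite sqrf_eq1 => /orP[]/eqP ft /eqP;
    rewrite sqrf_eq1 => /orP[]/eqP fu; move: fneq; rewrite ft fu ?opprK //.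
have [c _ fc] : exists2 c, c \in `[t, u]%R & f c = 0.
  apply: IVT => //.
    apply: continuous_in_subspaceT => z.
    rewrite inE /= in_itv /= => /andP[tz zu]; apply: cf => /=.
    move: tx ux; rewrite /= !in_itv /= => /andP[xt _] /andP[_ uy].
    by rewrite (lt_le_trans xt tz) (le_lt_trans zu uy).
  rewrite fN ge_min le_max oppr_le0 oppr_ge0.
  by case: (leP 0 (f t)) => [|/ltW ->]; rewrite ?orbT.
by have := f2 c; rewrite fc expr0n => /esym/eqP; rewrite oner_eq0.
Qed.

(** On the overlap the two signs differ by a constant [ep]. Correcting [s'] by [ep] makes them agree
    there, and they are pasted at the midpoint [m]. *)
Let lift_glue a b c d s s' : a < c -> c < b -> b < d ->
  lift `]a, b[%classic s -> lift `]c, d[%classic s' ->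
  exists s2, lift `]a, d[%classic s2.
Proof.
move=> ac cb bd ls ls'.
have lsI : lift `]c, b[%classic s.
  by apply: lift_sub ls; apply: subset_itv_oo => //; exact: ltW.
have lsI' : lift `]c, b[%classic s'.
  by apply: lift_sub ls'; apply: subset_itv_oo => //; exact: ltW.
pose m := (b + c) / 2; have m_itv : `]c, b[%classic m.
  by rewrite /= in_itv /= /m; apply/andP; split; lra.
have rigid := lift_rigid lsI lsI' m_itv.
move: (ls) (ls') => [ss sf] [ss' sf'].
pose ep := s m * s' m; have ep2 : ep * ep = 1 by rewrite mulrACA ss ss' mulr1.
pose s2 t := if t <= m then s t else ep * s' t.
have epE t : c < t -> t < b -> ep * s' t = s t.
  move=> ct tb; rewrite /ep (rigid t); last by rewrite /= in_itv /= ct.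
  by rewrite -mulrA ss' mulr1.
have /andP[cm mb] : c < m < b by move: m_itv; rewrite /= in_itv.
have s2l t : t < b -> s2 t = s t.
  by rewrite /s2; case: (leP t m) => // mt tb; rewrite epE // (lt_trans cm mt).
have s2r t : c < t -> s2 t = ep * s' t.
  by rewrite /s2; case: (leP t m) => // tm ct; rewrite epE // (le_lt_trans tm mb).
exists s2; split=> [t|i].
  by rewrite /s2; case: ifP => _ //; rewrite mulrACA ep2 ss' mulr1.
apply: smooth_near => t; rewrite /= in_itv /= => /andP[ta td].
case: (ltP t b) => tb.
  exists `]a, b[%classic, (fun t => s t * e i t); split=> //.
  - by rewrite /= in_itv /= ta.
  - by move=> u /=; rewrite in_itv /= => /andP[_ /s2l ->].
exists `]c, d[%classic, (fun t => ep * (s' t * e i t)); split=> //.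
- by rewrite /= in_itv /= td (lt_le_trans cb tb).
- by apply: smoothM => //; exact: smooth_cst.
- by move=> u /=; rewrite in_itv /= => /andP[/s2r -> _]; rewrite mulrA.
Qed.

(** A supremum argument on the right ends [b] that admit a lift: were they bounded, a local lift
    around their supremum would extend a lift beyond it. *)
Let lift_itv a b : a < b -> exists s, lift `]a, b[%classic s.
Proof.
pose T := [set b | a < b /\ exists s, lift `]a, b[%classic s].
have Tdown x y : T x -> a < y -> y <= x -> T y.
  move=> [ax [s ls]] ay yx; split=> //; exists s; apply: lift_sub ls.
  exact: subset_itv_oo.
have T0 : T !=set0.
  have [r [s [r0 ls]]] := lift_local a; exists (a + r); split; first lra.
  by exists s; apply: lift_sub ls; apply: subset_itv_oo; lra.
suff Tall c : a < c -> T c by move=> /Tall[].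
move=> ac; apply: contrapT => nTc.
have ubT : ubound T c.
  move=> x Tx; rewrite leNgt; apply/negP => cx; apply: nTc.
  by apply: Tdown Tx ac _; apply: ltW.
have supT : has_sup T by split=> //; exists c.
have [r [s' [r0 ls']]] := lift_local (sup T).
have [x Tx xr] := sup_adherent r0 supT.
have xs : x <= sup T by apply: ub_le_sup => //; exists c.
suff : T (sup T + r).
  by move=> /(ub_le_sup (ex_intro _ c ubT)); lra.
have [ax [s ls]] := Tx.
split; first lra.
(* Either the local lift covers the whole interval []a, sup T + r[], or it overlaps the lift on []a,
   x[] in []sup T - r, x[]. *)
case: (leP (sup T - r) a) => ra.
  exists s'; apply: lift_sub ls'.
  exact: subset_itv_oo.
by apply: (lift_glue ra xr _ ls ls'); lra.
Qed.

Lemma sign_lift : exists s : R -> R, sign_fun s /\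
  forall a, smooth k setT (fun t => s t * e a t).
Proof.
have lift_nat (N : nat) : exists s, lift `]- N.+1%:R, N.+1%:R[%classic s.
  by apply: lift_itv; rewrite gtrN // ltr0n.
have [S SP] := choice lift_nat.
(* The factor [S N 0] normalises each lift to the value 1 at 0; by rigidity the normalised lifts
   then agree on common intervals, so the choice of [N] above [|t|] is immaterial. *)
pose s t := let N := Num.bound `|t| in S N 0 * S N t.
exists s; split=> [t|a].
  by rewrite /s mulrACA; have [ss _] := SP (Num.bound `|t|); rewrite !ss mulr1.
have itvP (N : nat) (t : R) : `|t| < N%:R -> `]- N.+1%:R, N.+1%:R[%classic t.
  by rewrite itv_oppE => /lt_trans; apply; rewrite ltr_nat.
have itv0 (N : nat) : `]- N.+1%:R, N.+1%:R[%classic (0 : R).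
  by rewrite itv_oppE normr0 ltr0n.
have S_coh (N M : nat) (t : R) : (N <= M)%N -> `|t| < N%:R ->
    S N 0 * S N t = S M 0 * S M t.
  move=> NM tN.
  have lM : lift `]- N.+1%:R, N.+1%:R[%classic (S M).
    apply: lift_sub (SP M); apply: subset_itv_oo; rewrite ?lerN2 ler_nat //.
  have := lift_rigid (SP N) lM (itv0 N) (itvP _ _ tN).
  have [sN _] := SP N; have [sM _] := SP M.
  move=> q; rewrite -[LHS]mulr1 -(sM t) mulrACA -q mulrACA sN mul1r.
  exact: mulrC.
have boundP (t : R) : `|t| < (Num.bound `|t|)%:R by apply: archi_boundP.
apply: smooth_near => t _; pose N := Num.bound `|t|.
exists `]- N%:R, N%:R[%classic, (fun u => S N 0 * (S N u * e a u)); split.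
- exact: itv_open.
- by rewrite itv_oppE; exact: boundP.
- apply: smoothM; [exact: itv_open|exact: smooth_cst|].
  have [_ /(_ a)] := SP N; apply: smooth_sub.
  by apply: subset_itv_oo; rewrite ?lerN2 ler_nat.
- move=> u; rewrite itv_oppE => uN; rewrite mulrA /s.
  congr (_ * _); case: (leqP (Num.bound `|u|) N) => [MN|/ltnW NM].
    exact: S_coh.
  by apply/esym/S_coh.
Qed.

End Lift.

(** * Takagi factorization of a single matrix *)

Local Open Scope sesquilinear_scope.

(** Sorting gives a weak decrease, which injectivity makes strict. This puts the eigenvalues from
    the spectral theorem in order. *)
Lemma sorting_perm (R : realType) n (f : 'I_n -> R) : injective f ->
  exists s : 'S_n, forall i j : 'I_n, (i < j)%N -> f (s j) < f (s i).
Proof.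
move=> f_inj; pose t := [tuple f i | i < n].
have /tuple_permP[s tE] : perm_eq (sort >=%R t) t by rewrite perm_sort.
exists s => i j ij; rewrite lt_neqAle; apply/andP; split.
  by apply/eqP => /f_inj/perm_inj ji; move: ij; rewrite ji ltnn.
have nthE (m : 'I_n) : nth 0 (sort >=%R t) m = f (s m).
  by rewrite tE -tnth_nth !tnth_mktuple.
have : sorted >=%R (sort >=%R t) by apply: sort_sorted => x y; exact: le_total.
have geT : transitive (>=%R : rel R).
  by move=> x y z /= xy yz; exact: le_trans yz xy.
have geR : reflexive (>=%R : rel R) by move=> x /=.
move=> /(sorted_leq_nth geT geR 0)/(_ i j).
rewrite !inE size_sort size_tuple !ltn_ord => /(_ isT isT (ltnW ij)).
by rewrite !nthE.
Qed.

Section Takagi.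
Variables (R : realType) (n : nat).
Implicit Types (A U W : 'M[R[i]]_n) (sigma : 'I_n -> R).

Definition realdiag (f : 'I_n -> R) : 'M[R[i]]_n :=
  diag_mx (\row_j (f j)%:C).

Lemma mul_realdiagE m p (M : 'M[R[i]]_(m, n)) (N : 'M[R[i]]_(n, p)) f a b :
  (M *m realdiag f *m N) a b = \sum_j M a j * (f j)%:C * N j b.
Proof.
rewrite mxE; apply: eq_bigr => j _.
by rewrite /realdiag mul_mx_diag !mxE.
Qed.

Lemma conjC_real (x : R) : Num.conj (x%:C) = x%:C.
Proof. exact: conjc_real. Qed.

Lemma unitary_rowE W : W \is unitarymx ->
  forall i j, \sum_k W i k * (W j k)^* = (i == j)%:R.
Proof.
move=> /unitarymxP/matrixP WW i j; have := WW i j; rewrite !mxE => <-.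
by apply: eq_bigr => k _; rewrite !mxE.
Qed.

Lemma sorted_spectral A :
  injective (singular_value A) -> (forall i, 0 < singular_value A i) ->
  exists W sigma, [/\ W \is unitarymx,
    forall i j : 'I_n, (i < j)%N -> sigma j < sigma i,
    forall i, 0 < sigma i
  & A ^t* *m A = W ^t* *m realdiag (fun j => sigma j ^+ 2) *m W].
Proof.
move=> A_inj A_pos; set H := A ^t* *m A.
have Hherm : H \is hermsymmx.
  apply/is_hermitianmxP; rewrite expr0 scale1r /H trmx_mul map_mxM.
  by rewrite trmxCK.
have /orthomx_spectralP HE := hermitian_normalmx Hherm.
have dreal := hermitian_spectral_diag_real Hherm.
have dE j : spectral_diag H 0 j = (singular_value A j ^+ 2)%:C.
  have /mxOverP/(_ 0 j)/RRe_real dj := dreal.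
  rewrite -[LHS]dj /singular_value -/H sqr_sqrtr //.
  (* [Num.sqrt] is 0 on negative reals, so a positive singular value can only come from a positive
     eigenvalue. *)
  by apply: ltW; rewrite -sqrtr_gt0; apply: (A_pos j).
have [s s_decr] := sorting_perm A_inj.
have Wu := spectral_unitarymx H; set W := spectralmx H in Wu HE.
exists (row_perm s W), (singular_value A \o s); split.
- apply/unitarymxP/matrixP => i j.
  rewrite !mxE -(inj_eq (@perm_inj _ s)) -(unitary_rowE Wu).
  by apply: eq_bigr => k _; rewrite !mxE.
- exact: s_decr.
- by move=> i; apply: A_pos.
apply/matrixP => a b; rewrite mul_realdiagE HE invmx_unitary // mxE.
rewrite (reindex_inj (@perm_inj _ s)) /=; apply: eq_bigr => j _.
by rewrite mul_mx_diag !mxE dE.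
Qed.

Lemma takagi A : A^T = A ->
  injective (singular_value A) -> (forall i, 0 < singular_value A i) ->
  exists U sigma, [/\ U \is unitarymx,
    forall i j : 'I_n, (i < j)%N -> sigma j < sigma i,
    forall i, 0 < sigma i
  & A = U *m realdiag sigma *m U^T].
Proof.
move=> A_sym A_inj A_pos.
have [W [sigma [Wu s_decr s_gt0 AE]]] := sorted_spectral A_inj A_pos.
pose D := realdiag (fun j => sigma j ^+ 2).
(* [C] must be opaque: [map_mxM] would see a product through a [pose]. *)
have [C CE] : exists C, C = map_mx Num.conj W *m A *m W ^t*.
  by exists (map_mx Num.conj W *m A *m W ^t*).
have WW : W *m W ^t* = 1%:M by apply/unitarymxP.
have WW' : W ^t* *m W = 1%:M.
  by rewrite -invmx_unitary // mulVmx // unitarymx_unit.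
have conjK m p (M : 'M[R[i]]_(m, p)) : map_mx Num.conj (map_mx Num.conj M) = M.
  by apply/matrixP => i j; rewrite !mxE conjCK.
have WcW : W^T *m map_mx Num.conj W = 1%:M.
  by rewrite -(conjK _ _ W^T) -map_mxM WW' map_mx1.
have C_sym : C^T = C.
  by rewrite CE !trmx_mul A_sym map_trmx trmxK -map_trmx mulmxA.
have CC : map_mx Num.conj C *m C = D.
  have -> : map_mx Num.conj C = W *m A ^t* *m W^T.
    by rewrite CE !map_mxM conjK conjK A_sym.
  rewrite CE !mulmxA -(mulmxA _ W^T) WcW mulmx1 -(mulmxA W) AE !mulmxA WW mul1mx.
  by rewrite -mulmxA WW mulmx1.
have CC' : C *m map_mx Num.conj C = D.
  have -> : C *m map_mx Num.conj C = map_mx Num.conj (map_mx Num.conj C *m C).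
    by rewrite map_mxM conjK.
  by rewrite CC; apply/matrixP => i j; rewrite !mxE rmorphMn /= conjC_real.
have CD : C *m D = D *m C by rewrite -{1}CC mulmxA CC'.
(* The entry [(i, j)] of [C D = D C] says that [C i j] times the difference of two distinct squares
   vanishes. *)
have C_diag i j : i != j -> C i j = 0.
  move=> ij; have /matrixP/(_ i j) := CD.
  rewrite /D /realdiag mul_mx_diag mul_diag_mx !mxE mulrC => /eqP.
  rewrite -subr_eq0 -mulrBl mulf_eq0 => /orP[|/eqP //].
  rewrite -rmorphB fmorph_eq0 subr_eq0 eqrXn2 ?ltW // => /eqP sij.
  case: (ltngtP i j) => [/s_decr|/s_decr|/val_inj eij].
  - by rewrite sij ltxx.
  - by rewrite sij ltxx.
  - by rewrite eij eqxx in ij.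
have C_norm i : (C i i)^* * C i i = (sigma i ^+ 2)%:C.
  have /matrixP/(_ i i) := CC; rewrite !mxE eqxx mulr1n => <-.
  rewrite (bigD1 i) //= big1 ?addr0 ?mxE // => j ji.
  by rewrite C_diag ?mulr0.
(* A square root of the phase of [C i i]: with [Theta] the diagonal matrix of these,
   [C = Theta S Theta], and [A = W^T C W] yields [U = W^T Theta]. *)
pose theta i := sqrtC (C i i / (sigma i)%:C).
have sigma_neq0 i : (sigma i)%:C != 0 by rewrite fmorph_eq0 gt_eqF.
have theta2 i : theta i ^+ 2 * (sigma i)%:C = C i i.
  by rewrite sqrtCK divfK.
(* The left side is nonnegative, so it suffices that its square is 1, which follows from
   [C_norm]. *)
have theta_norm i : theta i * (theta i)^* = 1.
  apply/eqP; rewrite -sqrp_eq1 ?mul_conjC_ge0 // exprMn -rmorphXn /= sqrtCK.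
  rewrite rmorphM fmorphV /= conjC_real mulrACA mulrC [X in _ * X]mulrC C_norm.
  by rewrite rmorphXn -expr2 exprVn mulVf // expf_neq0.
exists (W^T *m diag_mx (\row_j theta j)), sigma; split=> //.
  apply: mul_unitarymx; first by rewrite trmx_unitary.
  apply/unitarymxP/matrixP => i j.
  rewrite mul_diag_mx !mxE; case: (eqVneq i j) => [->|ij].
    by rewrite !mulr1n theta_norm.
  by rewrite mulr0n rmorph0 mulr0.
have -> : A = W^T *m C *m W.
  by rewrite CE !mulmxA WcW mul1mx -mulmxA WW' mulmx1.
rewrite trmx_mul trmxK tr_diag_mx !mulmxA; congr (_ *m W).
rewrite -!mulmxA; congr (_ *m _); rewrite mulmx_diag mulmx_diag.
apply/matrixP => i j; rewrite !mxE; case: (eqVneq i j) => [->|/C_diag //].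
by rewrite mulr1n -theta2 expr2 -mulrA; congr (_ * _); exact: mulrC.
Qed.

End Takagi.

(** * Smooth families *)

Section ComplexSmooth.
Variables (R : realType) (k : nat).
Implicit Types f g : R -> R[i].

Definition csmooth f := smooth k setT (fun t => complex.Re (f t)) /\
  smooth k setT (fun t => complex.Im (f t)).

Lemma eq_csmooth f g : (forall t, f t = g t) -> csmooth g -> csmooth f.
Proof. by move=> /funext ->. Qed.

Lemma csmooth_real (h : R -> R) : smooth k setT h -> csmooth (fun t => (h t)%:C).
Proof. by move=> sh; split=> //; exact: smooth_cst. Qed.

Lemma csmooth_cst c : csmooth (fun=> c).
Proof. by split; exact: smooth_cst. Qed.

Lemma csmoothD f g : csmooth f -> csmooth g -> csmooth (fun t => f t + g t).
Proof.
move=> [f1 f2] [g1 g2]; split.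
- apply: (eq_smooth openT _ (smoothD openT f1 g1)) => t _.
  by case: (f t) (g t) => ? ? [].
- apply: (eq_smooth openT _ (smoothD openT f2 g2)) => t _.
  by case: (f t) (g t) => ? ? [].
Qed.

Lemma csmoothM f g : csmooth f -> csmooth g -> csmooth (fun t => f t * g t).
Proof.
move=> [f1 f2] [g1 g2]; split.
- apply: (eq_smooth openT _ (smoothB openT (smoothM openT f1 g1)
    (smoothM openT f2 g2))) => t _.
  by case: (f t) (g t) => ? ? [].
- apply: (eq_smooth openT _ (smoothD openT (smoothM openT f1 g2)
    (smoothM openT f2 g1))) => t _.
  by case: (f t) (g t) => ? ? [].
Qed.

Lemma csmoothN f : csmooth f -> csmooth (fun t => - f t).
Proof.
move=> /(csmoothM (csmooth_cst (-1))); apply: eq_csmooth => t.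
by rewrite mulN1r.
Qed.

Lemma csmooth_conj f : csmooth f -> csmooth (fun t => (f t)^*).
Proof.
move=> [f1 f2]; split.
- by apply: (eq_smooth openT _ f1) => t _; case: (f t).
- by apply: (eq_smooth openT _ (smoothN openT f2)) => t _; case: (f t).
Qed.

Lemma csmooth_sum (I : Type) (r : seq I) (P : pred I) (F : I -> R -> R[i]) :
  (forall i, P i -> csmooth (F i)) -> csmooth (fun t => \sum_(i <- r | P i) F i t).
Proof.
move=> sF; elim: r => [|i r IH].
  by apply: eq_csmooth (csmooth_cst 0) => t; rewrite big_nil.
have [Pi|Pi] := boolP (P i).
  by apply: eq_csmooth (csmoothD (sF i Pi) IH) => t; rewrite big_cons Pi.
by apply: eq_csmooth IH => t; rewrite big_cons (negbTE Pi).
Qed.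

Definition psmooth (p : R -> {poly R[i]}) := forall m, csmooth (fun t => (p t)`_m).

Lemma eq_psmooth p q : (forall t, p t = q t) -> psmooth q -> psmooth p.
Proof. by move=> /funext ->. Qed.

Lemma psmooth_cst p : psmooth (fun=> p).
Proof. by move=> m; exact: csmooth_cst. Qed.

Lemma psmoothM p q : psmooth p -> psmooth q -> psmooth (fun t => p t * q t).
Proof.
move=> sp sq m; apply: (eq_csmooth (fun t => coefM _ _ _)).
by apply: csmooth_sum => j _; apply: csmoothM.
Qed.

Lemma psmooth_sum (I : Type) (r : seq I) (F : I -> R -> {poly R[i]}) :
  (forall i, psmooth (F i)) -> psmooth (fun t => \sum_(i <- r) F i t).
Proof.
move=> sF m; apply: (eq_csmooth (fun t => coef_sum _ _ _ _)).
by apply: csmooth_sum => j _; apply: sF.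
Qed.

Lemma psmooth_prod (I : Type) (r : seq I) (F : I -> R -> {poly R[i]}) :
  (forall i, psmooth (F i)) -> psmooth (fun t => \prod_(i <- r) F i t).
Proof.
move=> sF; elim: r => [|i r IH].
  by apply: eq_psmooth (psmooth_cst 1) => t; rewrite big_nil.
by apply: eq_psmooth (psmoothM (sF i) IH) => t; rewrite big_cons.
Qed.

Definition msmooth m n (M : R -> 'M[R[i]]_(m, n)) :=
  forall i j, csmooth (fun t => M t i j).

Lemma class_C_cmxP m n (M : R -> 'M[R[i]]_(m, n)) :
  class_C_cmx k M <-> msmooth M.
Proof.
split=> [[re im] i j|sM].
  split; apply/smooth_class_C.
    by have := re i j; under eq_fun do rewrite mxE.
  by have := im i j; under eq_fun do rewrite mxE.
split=> i j; have [re im] := sM i j; apply/smooth_class_C.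
  by under eq_fun do rewrite mxE.
by under eq_fun do rewrite mxE.
Qed.

Lemma msmoothM m n p (M : R -> 'M[R[i]]_(m, n)) (N : R -> 'M[R[i]]_(n, p)) :
  msmooth M -> msmooth N -> msmooth (fun t => M t *m N t).
Proof.
move=> sM sN i j; apply: (eq_csmooth (fun t => mxE _ _ _ _)).
by apply: csmooth_sum => l _; apply: csmoothM.
Qed.

(** The expansion of the determinant over permutations is a sum of products of entries of [X - M],
    whose coefficients are smooth. *)
Lemma psmooth_char_poly n (M : R -> 'M[R[i]]_n) :
  msmooth M -> psmooth (fun t => char_poly (M t)).
Proof.
move=> sM; apply: psmooth_sum => s; apply: psmoothM; first exact: psmooth_cst.
apply: psmooth_prod => i m.
apply: (@eq_csmooth _ (fun t => (('X : {poly R[i]}) *+ (i == s i))`_m +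
   - (if m == 0%N then M t i (s i) else 0))).
  by move=> t; rewrite !mxE coefB coefC.
apply: csmoothD; first exact: csmooth_cst.
by apply: csmoothN; case: m => [|m] /=; [exact: sM|exact: csmooth_cst].
Qed.

End ComplexSmooth.

Lemma char_poly_conj (F : comNzRingType) n (U V D : 'M[F]_n) :
  U *m V = 1%:M -> char_poly (U *m D *m V) = char_poly D.
Proof.
move=> UV; pose pm := map_mx (@polyC F).
have pUV : pm n n U *m pm n n V = 1%:M by rewrite -map_mxM UV map_mx1.
have -> : char_poly (U *m D *m V) =
    \det (pm n n U *m char_poly_mx D *m pm n n V).
  rewrite /char_poly /char_poly_mx mulmxBr mulmxBl -!map_mxM.
  by rewrite scalar_mxC -(mulmxA 'X%:M) pUV mulmx1.
rewrite !det_mulmx mulrAC -det_mulmx pUV det1 mul1r.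
by [].
Qed.

(** * From pointwise Takagi factorizations to one of class C^k *)

Section Assembly.
Variables (R : realType) (k n : nat) (A U : R -> 'M[R[i]]_n).
Variable sigma : 'I_n -> R -> R.
Hypothesis A_smooth : msmooth k A.
Hypothesis U_unitary : forall t, U t \is unitarymx.
Hypothesis sigma_decr : forall t (i j : 'I_n), (i < j)%N ->
  sigma j t < sigma i t.
Hypothesis sigma_gt0 : forall t i, 0 < sigma i t.
Hypothesis takagiA : forall t,
  A t = U t *m realdiag (fun i => sigma i t) *m (U t)^T.

Let lam i t := sigma i t ^+ 2.
Let H t := A t *m (A t)^t*.

Let UU t : (U t)^t* *m U t = 1%:M.
Proof.
by rewrite -invmx_unitary ?U_unitary // mulVmx // unitarymx_unit ?U_unitary.
Qed.

Let realdiagM (f g : 'I_n -> R) :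
  realdiag f *m realdiag g = realdiag (fun i => f i * g i).
Proof.
rewrite /realdiag mulmx_diag; congr diag_mx; apply/rowP => i.
by rewrite !mxE rmorphM.
Qed.

(** The diagonal factor is real and [U^T conj(U) = 1], so the two inner unitary factors of [A A^*]
    cancel. *)
Let HE t : H t = U t *m realdiag (lam^~ t) *m (U t)^t*.
Proof.
have conjA : (A t)^t* =
    map_mx Num.conj (U t) *m realdiag (sigma^~ t) *m (U t)^t*.
  rewrite takagiA !trmx_mul !map_mxM trmxK tr_diag_mx mulmxA.
  congr (_ *m _ *m _); apply/matrixP => i j.
  by rewrite !mxE rmorphMn /= conjC_real.
rewrite /H conjA {1}takagiA !mulmxA -(mulmxA _ (U t)^T).
have -> : (U t)^T *m map_mx Num.conj (U t) = 1%:M.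
  apply: trmx_inj; rewrite trmx_mul trmxK trmx1 -[RHS](UU t).
  by rewrite map_trmx.
by rewrite mulmx1 -(mulmxA (U t)) realdiagM.
Qed.

Let lam_decr t (i j : 'I_n) : (i < j)%N -> lam j t < lam i t.
Proof. by move=> ij; rewrite ltrXn2r // ?ltW ?sigma_decr. Qed.

Let H_smooth : msmooth k H.
Proof.
apply: msmoothM => // i j; apply: (@eq_csmooth _ _ _ (fun t => (A t j i)^*)).
  by move=> t; rewrite !mxE.
exact: csmooth_conj.
Qed.

Let lam_smooth i : smooth k setT (lam i).
Proof.
apply: smooth_root => [|m]; first exact: lam_decr.
have [sm _] := psmooth_char_poly H_smooth m.
apply: (eq_smooth openT _ sm) => t _.
rewrite HE char_poly_conj; last by apply/unitarymxP/U_unitary.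
rewrite char_poly_trig; last exact: diag_mx_is_trig.
(* The characteristic polynomial has real roots, hence real coefficients: their real parts are the
   coefficients that [smooth_root] asks for. *)
have -> : \prod_j ('X - (realdiag (lam^~ t) j j)%:P) =
    map_poly (real_complex R) (\prod_j ('X - (lam j t)%:P)).
  rewrite rmorph_prod; apply: eq_bigr => j _.
  by rewrite rmorphB /= map_polyX map_polyC /= !mxE eqxx mulr1n.
by rewrite coef_map.
Qed.

Lemma sigma_smooth i : smooth k setT (sigma i).
Proof.
apply: (eq_smooth openT _ (smooth_sqrt openT _ (lam_smooth i))) => t _.
  by rewrite sqrtr_sqr ger0_norm // ltW.
by rewrite exprn_gt0.
Qed.

Let realdiagB (f g : 'I_n -> R) :
  realdiag f - realdiag g = realdiag (fun i => f i - g i).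
Proof.
by apply/matrixP => i j; rewrite !mxE -mulrnBl -rmorphB.
Qed.

Let spectral_prod t (s : seq 'I_n) l := \prod_(j <- s) (lam l t - lam j t).

(** The matrix [M] is the product of the [H - lam j] over [j] in [s]; it is smooth because [H] and
    the [lam j] are, although [U] need not be. *)
Let smooth_spectral_prod (s : seq 'I_n) : exists M, msmooth k M /\
  forall t, M t = U t *m realdiag (spectral_prod t s) *m (U t)^t*.
Proof.
have UU' t : U t *m (U t)^t* = 1%:M by apply/unitarymxP/U_unitary.
have realdiag_cst (c : R) : realdiag (fun=> c) = (c%:C)%:M :> 'M[R[i]]_n.
  by apply/matrixP => i j; rewrite !mxE.
elim: s => [|j s [M [sM ME]]].
  exists (fun=> 1%:M); split=> [a b|t]; first exact: csmooth_cst.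
  rewrite (_ : spectral_prod t [::] = fun=> 1).
    by rewrite realdiag_cst mulmx1 UU'.
  by apply/funext => l; rewrite /spectral_prod big_nil.
exists (fun t => (H t - realdiag (fun=> lam j t)) *m M t); split=> [|t].
  apply: msmoothM => // a b.
  apply: (@eq_csmooth _ _ _ (fun t => H t a b +
    - ((lam j t)%:C * (a == b)%:R))).
    by move=> t; rewrite !mxE mulr_natr; case: eqVneq => [->|].
  apply: csmoothD; first exact: H_smooth.
  apply: csmoothN; apply: csmoothM; last exact: csmooth_cst.
  exact: csmooth_real.
have -> : H t - realdiag (fun=> lam j t) =
    U t *m realdiag (fun l => lam l t - lam j t) *m (U t)^t*.
  by rewrite -realdiagB mulmxBr mulmxBl -HE realdiag_cst scalar_mxC
    -(mulmxA _%:M) UU' mulmx1.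
rewrite ME !mulmxA -(mulmxA _ ((U t)^t*)) UU mulmx1 -(mulmxA (U t)) realdiagM.
congr (_ *m realdiag _ *m _); apply/funext => l.
by rewrite /spectral_prod big_cons.
Qed.

Let realdiag_single m p (M : 'M[R[i]]_(m, n)) (N : 'M[R[i]]_(n, p)) f i a b :
  (forall l, l != i -> f l = 0) ->
  (M *m realdiag f *m N) a b = M a i * N i b * (f i)%:C.
Proof.
move=> f0; rewrite mul_realdiagE (bigD1 i) //= big1 ?addr0 => [|l li].
  by rewrite mulrAC.
by rewrite f0 // mulr0 mul0r.
Qed.

(* The products below do not change when [U a i] and [U b i] are replaced by
   their opposites, which is the only freedom in the choice of column [i]. *)
Let column_products_smooth i a b :
  csmooth k (fun t => U t a i * (U t b i)^*) /\
  csmooth k (fun t => U t a i * U t b i).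
Proof.
(* With only [i] left out, [spectral_prod t s] vanishes exactly off [i], so [M] is a nonzero
   multiple of [u u^*] for the column [u] of index [i]. *)
pose s := [seq j <- enum 'I_n | j != i].
have [M [sM ME]] := smooth_spectral_prod s.
have s0 t l : l != i -> spectral_prod t s l = 0.
  move=> li; apply/eqP; rewrite prodf_seq_eq0; apply/hasP; exists l => /=.
    by rewrite mem_filter li mem_enum.
  by rewrite subrr.
have c_neq0 t : spectral_prod t s i != 0.
  rewrite prodf_seq_neq0; apply/allP => j; rewrite mem_filter /= subr_eq0.
  move=> /andP[ji _]; apply: contra ji => /eqP.
  by move=> eij; rewrite (roots_inj lam_decr eij).
have sc : smooth k setT (fun t => (spectral_prod t s i)^-1).
  apply: smoothV => // [|]; first exact: openT.
  apply: smooth_prod => [|j _]; first exact: openT.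
  by apply: smoothB => //; exact: openT.
split.
  apply: (@eq_csmooth _ _ _ (fun t => M t a b * ((spectral_prod t s i)^-1)%:C)).
    move=> t; rewrite ME (@realdiag_single _ _ _ _ _ i) ?mxE; last exact: s0.
    by rewrite -mulrA -rmorphM mulfV // mulr1.
  exact: csmoothM (csmooth_real sc).
(* In [M A] the factor [U^* U] cancels, leaving [u u^T] times [spectral_prod t s i * sigma i t]. *)
apply: (@eq_csmooth _ _ _ (fun t => (M t *m A t) a b *
    ((spectral_prod t s i)^-1 * (sigma i t)^-1)%:C)).
  move=> t; rewrite takagiA ME !mulmxA -(mulmxA _ ((U t)^t*)) UU mulmx1.
  rewrite -(mulmxA (U t)) realdiagM (@realdiag_single _ _ _ _ _ i); last first.
    by move=> l /s0 ->; rewrite mul0r.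
  rewrite !mxE -mulrA -rmorphM mulrACA !mulfV ?mulr1 //.
  by rewrite gt_eqF.
apply: csmoothM; first exact: msmoothM.
apply/csmooth_real/smoothM => //; first exact: openT.
apply: smoothV => [|t _|]; [exact: openT|by rewrite gt_eqF|exact: sigma_smooth].
Qed.

(** For complex [v] and [w], each product of a real or imaginary part of [v] with one of [w] is half
    a sum or difference ([c] is 1 or -1) of parts of [v conj(w)] and [v w]. *)
Let half_comb f g h (c : R) : (forall t, f t = (g t + c * h t) / 2) ->
  smooth k setT g -> smooth k setT h -> smooth k setT f.
Proof.
move=> fE sg sh; apply: (eq_smooth openT (fun t _ => fE t)).
apply: smoothM => //; [exact: openT| |exact: smooth_cst].
apply: smoothD => //; first exact: openT.
by apply: smoothM => //; [exact: openT|exact: smooth_cst].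
Qed.

Let part (b : bool) : R[i] -> R := if b then @complex.Re R else @complex.Im R.

Let column_sign i : exists s : R -> R, (forall t, s t * s t = 1) /\
  forall a b, smooth k setT (fun t => s t * part b (U t a i)).
Proof.
have [||s [s1 ss]] := @sign_lift R k ('I_n * bool)%type
  (fun ab t => part ab.2 (U t ab.1 i)).
- move=> [a [|]] [b [|]] /=; have [[P1 P2] [T1 T2]] := column_products_smooth i a b.
  + apply: (half_comb (c := 1) _ P1 T1) => t.
    by case: (U t a i) (U t b i) => x y [z w] /=; field.
  + apply: (half_comb (c := -1) _ T2 P2) => t.
    by case: (U t a i) (U t b i) => x y [z w] /=; field.
  + apply: (half_comb (c := 1) _ P2 T2) => t.
    by case: (U t a i) (U t b i) => x y [z w] /=; field.
  + apply: (half_comb (c := -1) _ P1 T1) => t.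
    by case: (U t a i) (U t b i) => x y [z w] /=; field.
(* A column of a unitary matrix has norm 1, so its real coordinates do not all vanish. *)
- move=> t; apply: contrapT => /forallNP U0.
  have /matrixP/(_ i i) := UU t; rewrite !mxE eqxx big1 => [/esym/eqP|a _].
    by rewrite oner_eq0.
  have [/negP/negPn/eqP re /negP/negPn/eqP im] := (U0 (a, true), U0 (a, false)).
  suff -> : U t a i = 0 by rewrite mulr0.
  by apply/eqP; rewrite eq_complex; apply/andP; split; apply/eqP.
by exists s; split=> // a b; apply: (ss (a, b)).
Qed.

Lemma smooth_takagi : exists V, msmooth k V /\
  forall t, V t \is unitarymx /\
    A t = V t *m realdiag (fun i => sigma i t) *m (V t)^T.
Proof.
have [s sP] := choice column_sign.
(* A diagonal matrix of signs is unitary, and multiplying [S] by it on both sides gives [S] back. *)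
exists (fun t => U t *m realdiag (fun i => s i t)); split=> [a i|t].
  have [_ ss] := sP i; split.
    apply: (eq_smooth openT _ (ss a true)) => t _.
    rewrite mul_mx_diag !mxE; case: (U t a i) => x y /=.
    by rewrite mulr0 subr0 mulrC.
  apply: (eq_smooth openT _ (ss a false)) => t _.
  rewrite mul_mx_diag !mxE; case: (U t a i) => x y /=.
  by rewrite mulr0 add0r mulrC.
have s1 i : s i t * s i t = 1 by case: (sP i).
have trD f : (realdiag f)^T = realdiag f :> 'M[R[i]]_n by rewrite tr_diag_mx.
split.
  apply: mul_unitarymx => //; apply/unitarymxP; rewrite trD.
  have -> : map_mx Num.conj (realdiag (s^~ t)) = realdiag (s^~ t).
    by apply/matrixP => i j; rewrite !mxE rmorphMn /= conjC_real.
  rewrite realdiagM; apply/matrixP => i j; rewrite !mxE s1.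
  by case: eqVneq.
rewrite takagiA trmx_mul trD !mulmxA; congr (_ *m _).
rewrite -!mulmxA !realdiagM; congr (_ *m realdiag _); apply/funext => i.
by rewrite mulrC -mulrA s1 mulr1.
Qed.

End Assembly.

Theorem theorem2p4 (R : realType) (k n : nat) (A : R -> 'M[R[i]]_n)
    (n_gt0 : (0 < n)%N)
    (A_Ck : class_C_cmx k A)
    (A_sym : forall t : R, (A t)^T = A t)
    (A_distinct : forall t : R, injective (singular_value (A t)))
    (A_pos : forall (t : R) (i : 'I_n), 0 < singular_value (A t) i) :
  exists (U : R -> 'M[R[i]]_n) (S : R -> 'M[R]_n),
    [/\ class_C_cmx k U,
        class_C_mx k S
      & forall t : R,
          [/\ U t \is unitarymx,
              exists sigma : 'rV[R]_n,
                [/\ S t = diag_mx sigma,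
                    forall i j : 'I_n, (i < j)%N -> sigma 0 j < sigma 0 i
                  & forall i : 'I_n, 0 < sigma 0 i]
            & A t = U t *m map_mx (real_complex R) (S t) *m (U t)^T]].
Proof.
have A_smooth := (class_C_cmxP k A).1 A_Ck.
(* The factorizations are chosen independently at each [t], so [U0] has no regularity yet. *)
have [U0 U0P] := choice (fun t => takagi (A_sym t) (@A_distinct t) (A_pos t)).
have [sigma0 U0sP] := choice U0P.
pose sigma i t := sigma0 t i.
have U_unitary t : U0 t \is unitarymx by case: (U0sP t).
have sigma_decr t (i j : 'I_n) : (i < j)%N -> sigma j t < sigma i t.
  by case: (U0sP t) => _ h _ _; apply: h.
have sigma_gt0 t i : 0 < sigma i t by case: (U0sP t) => _ _ h _; apply: h.
have takagiA t : A t = U0 t *m realdiag (sigma^~ t) *m (U0 t)^T.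
  by case: (U0sP t).
have [U [sU UP]] := smooth_takagi A_smooth U_unitary sigma_decr sigma_gt0 takagiA.
have ssig := sigma_smooth A_smooth U_unitary sigma_decr sigma_gt0 takagiA.
exists U, (fun t => diag_mx (\row_i sigma i t)); split.
- exact/class_C_cmxP.
- move=> i j; apply/smooth_class_C.
  apply: (eq_smooth openT (g := fun t => sigma i t * (i == j)%:R)).
    by move=> t _; rewrite !mxE mulr_natr; case: eqVneq => [->|].
  by apply: smoothM => //; [exact: openT|exact: smooth_cst].
move=> t; have [Ut AE] := UP t; split=> //.
  by exists (\row_i sigma i t); split=> // [i j ij|i]; rewrite !mxE; auto.
rewrite {1}AE; congr (_ *m _ *m _); rewrite map_diag_mx; congr diag_mx.
by apply/rowP => i; rewrite !mxE.
Qed.
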